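(* Let $\mathcal{T}=((t,u),\mathcal{O},\mathcal{R})$ be a tiling with $\mathcal{R}=\{\mathcal{R}_1,\ldots,\mathcal{R}_k\}$, where each requirement list $\mathcal{R}_i$ is a finite set. Let $\ell_i$ be the size of the largest gridded permutation in $\mathcal{R}_i$ and $L=\ell_1+\cdots+\ell_k$. If $\operatorname{Grid}(\mathcal{T})$ is nonempty, then $\operatorname{Grid}(\mathcal{T})$ contains a gridded permutation of size at most $L$.
   Context: A gridded permutation of size $n$ is a pair $(\pi,(c_1,\ldots,c_n))$ with $\pi$ a permutation of $\{1,\ldots,n\}$ and cells $c_i=(x_i,y_i)\in\mathbb{N}^2$, consistent in the sense that $x_i\le x_j$ whenever $i<j$ and $y_i\le y_j$ whenever $\pi(i)<\pi(j)$. $\mathcal{G}^{(t,u)}$ is the set of gridded permutations with all cells in $\{0,\ldots,t-1\}\times\{0,\ldots,u-1\}$. $g=(\pi,(c_1,\ldots,c_n))$ contains $h=(\sigma,(d_1,\ldots,d_k))$ if there are indices $i_1<\cdots<i_k$ with $\pi(i_1)\cdots\pi(i_k)$ order-isomorphic to $\sigma$ and $c_{i_j}=d_j$ for all $j$. A tiling $\mathcal{T}=((t,u),\mathcal{O},\mathcal{R})$ consists of integers $t,u$, a set $\mathcal{O}$ of gridded permutations (obstructions) and a set $\mathcal{R}$ of sets of gridded permutations (requirement lists); $\operatorname{Grid}(\mathcal{T})$ is the set of $g\in\mathcal{G}^{(t,u)}$ avoiding every element of $\mathcal{O}$ and containing at least one element of each requirement list. *)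

(* Defs.v *)
From HB Require Import structures.
From mathcomp Require Import all_boot all_order all_fingroup.
From mathcomp Require Import boolp classical_sets cardinality fsbigop.

Set Implicit Arguments.
Unset Strict Implicit.
Unset Printing Implicit Defensive.

Local Open Scope classical_set_scope.

(* Positions, values and cells are all indexed from 0. *)
Definition consistent (n : nat) (pi : 'S_n) (c : {ffun 'I_n -> nat * nat}) :=
  [forall i : 'I_n, forall j : 'I_n,
    ((i < j) ==> ((c i).1 <= (c j).1)) &&
    ((pi i < pi j) ==> ((c i).2 <= (c j).2))].

Definition pre_gridded := {n : nat & ('S_n * {ffun 'I_n -> nat * nat})%type}.

Record gridded_perm := GriddedPerm {
  gp_data : pre_gridded;
  gp_consistent : consistent (tagged gp_data).1 (tagged gp_data).2
}.

HB.instance Definition _ := [isSub for gp_data].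
HB.instance Definition _ := [Choice of gridded_perm by <:].

Definition gp_size (g : gridded_perm) : nat := tag (gp_data g).
Definition gp_perm (g : gridded_perm) : 'S_(gp_size g) := (tagged (gp_data g)).1.
Definition gp_cell (g : gridded_perm) (i : 'I_(gp_size g)) : nat * nat :=
  (tagged (gp_data g)).2 i.

Definition gp_contains (g h : gridded_perm) : Prop :=
  exists f : 'I_(gp_size h) -> 'I_(gp_size g),
    [/\ forall a b : 'I_(gp_size h), a < b -> f a < f b,
        forall a b, (gp_perm g (f a) < gp_perm g (f b)) =
                    (gp_perm h a < gp_perm h b)
      & forall a, gp_cell (f a) = gp_cell a].

Definition gridded_in (t u : nat) : set gridded_perm :=
  [set g | forall i : 'I_(gp_size g), (gp_cell i).1 < t /\ (gp_cell i).2 < u].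

Record tiling := Tiling {
  tl_width : nat;
  tl_height : nat;
  tl_obs : set gridded_perm;
  tl_reqs : set (set gridded_perm)
}.

Definition Grid (T : tiling) : set gridded_perm :=
  [set g | [/\ gridded_in (tl_width T) (tl_height T) g,
               forall o, tl_obs T o -> ~ gp_contains g o
             & forall r, tl_reqs T r -> exists2 h, r h & gp_contains g h]].

(* Meaningful for finite r only; the value is 0 when r is empty, in which case
   a tiling having r as a requirement list has an empty Grid. *)
Definition max_size (r : set gridded_perm) : nat :=
  \big[maxn/0]_(h \in r) gp_size h.

(* Main.v *)
Require Import Defs.
From HB Require Import structures.
From mathcomp Require Import all_boot all_order all_fingroup.
From mathcomp Require Import boolp classical_sets cardinality fsbigop.
From mathcomp Require Import unstable.

Set Implicit Arguments.
Unset Strict Implicit.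
Unset Printing Implicit Defensive.

Local Open Scope classical_set_scope.

(* Choose, in some gridded permutation of the grid, one occurrence of an
   element of each requirement list.  The points of these occurrences form a
   gridded subpermutation of size at most L, which still meets all the
   requirements and, by transitivity of containment, avoids all the
   obstructions. *)

Section RankPerm.
Variables (m : nat) (v : 'I_m -> nat).
Hypothesis v_inj : injective v.

(** Counting smaller entries gives the standardization of the word [v]: distinct naturals are
    replaced by their ranks, counted from 0. *)
Let rank (a : 'I_m) := #|[pred b | v b < v a]|.

Let rank_lt a : rank a < m.
Proof.
rewrite -[X in _ < X](card_ord m); apply/proper_card/properP; split.
  by apply/fintype.subsetP.
by exists a; rewrite ?inE ?ltnn.
Qed.

Let ltn_rank a b : v a < v b -> rank a < rank b.
Proof.
move=> ab; apply/proper_card/properP; split.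
  by apply/fintype.subsetP => c; rewrite !inE => /ltn_trans; apply.
by exists a; rewrite ?inE ?ltnn.
Qed.

Let rank_mono a b : (rank a < rank b) = (v a < v b).
Proof.
(* By trichotomy, strict monotonicity in one direction already yields the equivalence. *)
have [/ltn_rank//|/ltn_rank ba|/v_inj ->] := ltngtP (v a) (v b).
  by rewrite ltnNge ltnW.
by rewrite ltnn.
Qed.

Let rank_inj : injective (fun a => Ordinal (rank_lt a)).
Proof.
move=> a b /(congr1 val) /= rab; apply: v_inj.
by case: (ltngtP (v a) (v b)) (rank_mono a b) (rank_mono b a) => //; rewrite rab ltnn.
Qed.

Definition rank_perm : 'S_m := perm rank_inj.

Lemma ltn_rank_perm a b : (rank_perm a < rank_perm b) = (v a < v b).
Proof. by rewrite !permE /= rank_mono. Qed.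

End RankPerm.

Lemma gp_consistentP (g : gridded_perm) (i j : 'I_(gp_size g)) :
  (i < j -> (gp_cell i).1 <= (gp_cell j).1) /\
  (gp_perm g i < gp_perm g j -> (gp_cell i).2 <= (gp_cell j).2).
Proof.
by have /forallP/(_ i)/forallP/(_ j)/andP[/implyP ? /implyP ?] := gp_consistent g.
Qed.

Lemma gp_contains_trans (g h o : gridded_perm) :
  gp_contains g h -> gp_contains h o -> gp_contains g o.
Proof.
move=> [f [f_lt f_perm f_cell]] [f' [f'_lt f'_perm f'_cell]].
exists (f \o f'); split => [a b ab|a b|a] /=.
- exact/f_lt/f'_lt.
- by rewrite f_perm f'_perm.
- by rewrite f_cell f'_cell.
Qed.

Lemma gridded_in_contains t u (g h : gridded_perm) :
  gp_contains g h -> gridded_in t u g -> gridded_in t u h.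
Proof. by move=> [f [_ _ f_cell]] gtu a; rewrite -f_cell; exact: gtu. Qed.

Section SubPattern.
Variables (g : gridded_perm) (m : nat) (e : 'I_m -> 'I_(gp_size g)).
Hypothesis e_mono : forall a b, (e a < e b) = (a < b).

Let e_inj : injective e.
Proof.
move=> a b eab; apply: val_inj.
by case: (ltngtP a b) (e_mono a b) (e_mono b a) => //; rewrite eab ltnn.
Qed.

Let perm_e_inj : injective (fun a => val (gp_perm g (e a))).
Proof. by move=> a b /val_inj/perm_inj/e_inj. Qed.

(** The restriction of [g] to the points selected by [e]: values are standardized, cells are kept as
    they are. *)
Let sub_data : pre_gridded :=
  Tagged (fun n => ('S_n * {ffun 'I_n -> nat * nat})%type)
    (rank_perm perm_e_inj, [ffun a => gp_cell (e a)]).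

Let sub_consistent : consistent (tagged sub_data).1 (tagged sub_data).2.
Proof.
apply/forallP => a; apply/forallP => b; rewrite /= !ffunE ltn_rank_perm -e_mono.
by have [? ?] := gp_consistentP (e a) (e b); apply/andP; split; apply/implyP.
Qed.

Definition gp_sub : gridded_perm := GriddedPerm sub_consistent.

Lemma gp_sub_perm (a b : 'I_m) :
  (gp_perm gp_sub a < gp_perm gp_sub b) = (gp_perm g (e a) < gp_perm g (e b)).
Proof. exact: ltn_rank_perm. Qed.

Lemma gp_sub_cell (a : 'I_m) : gp_cell (a : 'I_(gp_size gp_sub)) = gp_cell (e a).
Proof. exact: ffunE. Qed.

Lemma gp_contains_sub : gp_contains g gp_sub.
Proof.
exists e; split => [a b|a b|a]; first by rewrite e_mono.
- by rewrite gp_sub_perm.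
- by rewrite gp_sub_cell.
Qed.

(** An occurrence whose points all lie in the image of [e] factors as [e \o f'], and [f'] is
    increasing because [e] also reflects the order. *)
Lemma gp_sub_contains (h : gridded_perm) (f : 'I_(gp_size h) -> 'I_(gp_size g)) :
    (forall a b : 'I_(gp_size h), a < b -> f a < f b) ->
    (forall a b, (gp_perm g (f a) < gp_perm g (f b)) =
                 (gp_perm h a < gp_perm h b)) ->
    (forall a, gp_cell (f a) = gp_cell a) ->
    (forall a, exists b, e b = f a) ->
  gp_contains gp_sub h.
Proof.
move=> f_lt f_perm f_cell /choice[f' ef'].
exists (f' : _ -> 'I_(gp_size gp_sub)); split => [a b ab|a b|a].
- by rewrite -e_mono !ef' f_lt.
- by rewrite gp_sub_perm !ef'.
- by rewrite gp_sub_cell ef'.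
Qed.

End SubPattern.

Lemma ltn_enum_val n (A : {set 'I_n}) (a b : 'I_#|A|) :
  (enum_val a < enum_val b) = (a < b).
Proof.
have lt_enum (c d : 'I_#|A|) : c < d -> enum_val c < enum_val d.
  move=> cd; have x0 := enum_val c.
  (* [enum A] filters the enumeration of ['I_n], whose values form an increasing [iota]. [x0] only
     serves as the default of [nth]. *)
  have sA : sorted (relpre val ltn) (enum A).
    rewrite /enum_mem -enumT; apply: sorted_filter.
      by move=> ? ? ?; apply: ltn_trans.
    by rewrite -sorted_map val_enum_ord iota_ltn_sorted.
  rewrite !(enum_val_nth x0).
  apply: (sorted_ltn_nth _ x0 sA) => //; rewrite ?inE -?cardE //.
  by move=> ? ? ?; apply: ltn_trans.
have [/lt_enum//|/lt_enum ba|/val_inj ->] := ltngtP a b.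
  by rewrite ltnNge ltnW.
by rewrite ltnn.
Qed.

Lemma leq_max_size (r : set gridded_perm) (h : gridded_perm) :
  finite_set r -> r h -> gp_size h <= max_size r.
Proof.
by move=> finr rh; rewrite /max_size (fsbigD1 h) //; exact: leq_maxl.
Qed.

Theorem theorem6p3 (T : tiling) (k : nat) (R : 'I_k -> set gridded_perm)
    (defR : tl_reqs T = range R)
    (finR : forall i : 'I_k, finite_set (R i))
    (neT : Grid T !=set0) :
  exists2 g : gridded_perm,
    Grid T g & gp_size g <= \sum_(i < k) max_size (R i).
Proof.
case: neT => g [g_in g_av g_req].
have occ i : exists h, R i h /\ gp_contains g h.
  by have [|h Rh gh] := g_req (R i); [rewrite defR; exists i | exists h].
have [h Rgh] := choice occ.
(* [cid] turns the mere existence of an occurrence into a map [f i], whose image can then be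
   taken. *)
have emb i := cid (Rgh i).2.
pose f i := sval (emb i).
pose A := (\bigcup_(i < k) (f i @: [set: 'I_(gp_size (h i))]))%SET.
have g_sub := gp_contains_sub (@ltn_enum_val _ A).
exists (gp_sub (@ltn_enum_val _ A)).
  split.
  - exact: gridded_in_contains g_sub g_in.
  - by move=> o To /(gp_contains_trans g_sub); exact: g_av.
  - rewrite defR => _ [i _ <-]; exists (h i); first by have [] := Rgh i.
    have [f_lt f_perm f_cell] := svalP (emb i).
    apply: (gp_sub_contains (@ltn_enum_val _ A) f_lt f_perm f_cell) => // a.
    have fA : f i a \in A.
      by apply/bigcupP; exists i => //; apply: imset_f; rewrite inE.
    (* The preimage of [f i a] under [enum_val] is its rank in [A]; [fA] also witnesses that [A] is
       inhabited. *)
    by exists (enum_rank_in fA (f i a)); rewrite enum_rankK_in.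
apply: (@leq_trans (\sum_(i < k) gp_size (h i))); last first.
  by apply: leq_sum => i _; apply: leq_max_size => //; have [] := Rgh i.
(* Union bound: occurrences may share points, so [#|A|] is at most the sum of the sizes of their
   images. *)
rewrite -[gp_size (gp_sub _)]/#|A|; apply: leq_trans (card_big_setU _ _ _) _.
apply: leq_sum => i _.
by rewrite (leq_trans (leq_imset_card _ _)) // cardsT card_ord.
Qed.
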